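(* Let $\mathcal{H}$ be a separable Hilbert space, let $Y=m(X)+\varepsilon$ be the $\mathcal{H}$-valued regression model described in the context, let $x_0\in\mathcal{H}$, and assume that the Fréchet derivative $\mathcal{A}$ of the regression operator $m$ is a self-adjoint compact operator on $\mathcal{H}$ with the pure point spectral expansion $\mathcal{A}=\sum_{k\ge1}\lambda_k(\mathcal{A})\,\phi_k\otimes\phi_k$, where $\{\phi_k\}$ and $\{\lambda_k(\mathcal{A})\}$ are its eigenfunctions and eigenvalues. Consider the local linear minimization problem $$(\widehat{\beta_0},\widehat{\beta_1})=\arg\min_{\beta_0\in\mathcal{H},\ \beta_1\in\mathcal{L}(\mathcal{H})}L(\beta_0,\beta_1),\qquad L(\beta_0,\beta_1)=E\left[\|Y-\beta_0-\beta_1(X-x_0)\|_{\mathcal{H}}^2\,K_{B_n}\left(\|X-x_0\|_{\mathcal{H}}\right)\right],$$ by which $m(x_0)$ and $\mathcal{A}$ are estimated, with $\beta_0=m(x_0)$ and $\beta_1=\mathcal{A}$. Expanding $L(m(x_0),\mathcal{A})$ by Parseval's identity in terms of $\{\phi_k\}$, differentiating with respect to $\beta_0=m(x_0)$ and $\beta_1=\mathcal{A}$, and equating to zero gives the two equations $$E\left[K_{B_n}(\|X-x_0\|_{\mathcal{H}})\{m(x_0)-Y+\mathcal{A}(X-x_0)\}\right]=0,$$ $$E\left[K_{B_n}(\|X-x_0\|_{\mathcal{H}})\left(\langle\mathcal{A}(X-x_0),X-x_0\rangle_{\mathcal{H}}-\langle Y-m(x_0),X-x_0\rangle_{\mathcal{H}}\right)\right]=0.$$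 With the local moments $\mu_0,\mu_1,r_0,\mu_j^{(k)},r_j^{(k)}$ defined in the context, the first equation gives $$m(x_0)=\frac{r_0-\mathcal{A}(\mu_1)}{\mu_0},\qquad \langle m(x_0),\phi_k\rangle_{\mathcal{H}}=\frac{r_0^{(k)}-\lambda_k(\mathcal{A})\mu_1^{(k)}}{\mu_0},\quad k\ge1,$$ and the second equation reads $$0=\sum_{k\ge1}\left(\lambda_k(\mathcal{A})\mu_2^{(k)}-r_1^{(k)}+\langle m(x_0),\phi_k\rangle_{\mathcal{H}}\,\mu_1^{(k)}\right),$$ which, after substituting the first, becomes $$0=\sum_{k\ge1}\left(\lambda_k(\mathcal{A})\left[\mu_2^{(k)}-\frac{[\mu_1^{(k)}]^2}{\mu_0}\right]-r_1^{(k)}+\frac{r_0^{(k)}\mu_1^{(k)}}{\mu_0}\right).$$ In particular, this last equation holds when every summand ($k\ge1$) vanishes, which leads to $$\widehat{\lambda_k}(\mathcal{A})=\frac{\mu_0r_1^{(k)}-r_0^{(k)}\mu_1^{(k)}}{\sigma_0^2(k)},\qquad \sigma_0^2(k)=\mu_2^{(k)}\mu_0-[\mu_1^{(k)}]^2,\qquad k\ge1,$$ that is, $\widehat{\mathcal{A}}(f)(g)=\sum_{k\ge1}\widehat{\lambda_k}(\mathcal{A})\langle f,\phi_k\rangle_{\mathcal{H}}\langle g,\phi_k\rangle_{\mathcal{H}}$ for $f,g\in\mathcal{H}$, and to $$\widehat{m(x_0)}(\phi_k)=\frac{\mu_2^{(k)}r_0^{(k)}-\mu_1^{(k)}r_1^{(k)}}{\sigma_0^2(k)}=E\left[S^{(k)}(X,x_0,B_n)\,Y(\phi_k)\right],\qquad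 k\ge 1,$$ where $$S^{(k)}(X,x_0,B_n)=\frac{1}{\sigma_0^2(k)}K_{B_n}\left(\|X-x_0\|_{\mathcal{H}}\right)\left[\mu_2^{(k)}-\mu_1^{(k)}(X-x_0)(\phi_k)\right].$$ Moreover $E[S^{(k)}(X,x_0,B_n)]=1$ for every $k\ge1$; hence $\widehat{m(x_0)}(\phi_k)$ can be rewritten as $$\widehat{m(x_0)}(\phi_k)=\arg\min_{h\in\mathcal{H}}E\left[S^{(k)}(X,x_0,B_n)\,[Y(\phi_k)-h(\phi_k)]^2\right],\qquad k\ge1,$$ (the value $h(\phi_k)$ at the minimum). The resulting local linear functional regression predictor at $x_0$ is $$\widehat{Y}(x_0)=\widehat{m(x_0)}=\sum_{k\ge1}\widehat{m(x_0)}(\phi_k)\,\phi_k.$$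
   Context: $X$ and $Y$ are $\mathcal{H}$-valued random elements on a probability space with probability measure $P$, with $Y=m(X)+\varepsilon$, $P[\varepsilon\in\mathcal{H}]=1$, $E[\varepsilon\mid X]=0$, $E[\|\varepsilon\|_{\mathcal{H}}^2\mid X]=\sigma_\varepsilon^2<\infty$; $m:\mathcal{H}\to\mathcal{H}$, $m(x_0)=E[Y\mid X=x_0]$, is the regression operator. It is assumed that $m$ admits a Fréchet derivative given by a bounded linear operator $\mathcal{A}$ such that $\lim_{\|h\|_{\mathcal{H}}\to0}\|m(x+h)-m(x)-\mathcal{A}(h)\|_{\mathcal{H}}/\|h\|_{\mathcal{H}}=0$ for all $x\in\mathcal{H}$; this motivates the local linear approximation $m(x)\sim m(x_0)+\mathcal{A}(x-x_0)$ for $x$ close to $x_0$ in $\mathcal{H}$. $\mathcal{L}(\mathcal{H})$ is the space of bounded linear operators on $\mathcal{H}$. $K$ is a probability density, $B_n$ is a bandwidth parameter indexed by the sample size $n$, with $B_n\to0$ as $n\to\infty$, and $K_{B_n}$ denotes the kernel $K$ with bandwidth $B_n$. For $f\in\mathcal{H}$ write $f(\phi_k)=\langle f,\phi_k\rangle_{\mathcal{H}}$. The local moments are $$\mu_0=E\left[K_{B_n}(\|X-x_0\|_{\mathcal{H}})\right],\quad \mu_1=E\left[K_{B_n}(\|X-x_0\|_{\mathcal{H}})(X-x_0)\right],\quad r_0=E\left[K_{B_n}(\|X-x_0\|_{\mathcal{H}})Y\right],$$ $$\mu_j^{(k)}=E\left[[(X-x_0)(\phi_k)]^jK_{B_n}(\|X-x_0\|_{\mathcal{H}})\right]\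 (j\ge1),$$ $$r_j^{(k)}=E\left[K_{B_n}(\|X-x_0\|_{\mathcal{H}})\,[(X-x_0)(\phi_k)]^j\,Y(\phi_k)\right]\ (j\ge0).$$ *)

(* Defs.v *)
From HB Require Import structures.
From mathcomp Require Import all_boot all_order all_algebra.
From mathcomp Require Import all_classical all_reals all_analysis.

Set Implicit Arguments.
Unset Strict Implicit.
Unset Printing Implicit Defensive.

Import Order.TTheory GRing.Theory Num.Theory.
Import numFieldNormedType.Exports.

Local Open Scope classical_set_scope.
Local Open Scope ring_scope.

(* Real Hilbert spaces: complete normed modules whose norm comes from an inner
   product.  Positive definiteness follows from inner_norm, and linearity in
   the second argument from symmetry. *)
HB.mixin Record isHilbert (R : realType) H of CompleteNormedModule R H := {
  inner : H -> H -> R ;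
  innerC : forall x y, inner x y = inner y x ;
  innerDl : forall x y z, inner (x + y) z = inner x z + inner y z ;
  innerZl : forall (a : R) x y, inner (a *: x) y = a * inner x y ;
  inner_norm : forall x, inner x x = `|x| ^+ 2 }.

#[short(type="hilbertType")]
HB.structure Definition Hilbert (R : realType) :=
  {H of isHilbert R H & CompleteNormedModule R H}.

Notation "[< x , y >]" := (inner x y)
  (at level 0, x at level 99, y at level 99, format "[< x ,  y >]")
  : ring_scope.

Definition separable (T : topologicalType) : Prop :=
  exists2 S : set T, countable S & dense S.

Section HilbertDefs.
Context (R : realType) (H : hilbertType R).

(* The sum of u k over the k satisfying D.  Bases of H are indexed by such a D:
   predT if H is infinite-dimensional, an initial segment of nat otherwise. *)
Definition is_sum (V : normedModType R) (D : pred nat) (u : nat -> V) (s : V)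
  : Prop :=
  (fun n : nat => \sum_(k < n | D k) u k) @ \oo --> s.

Definition orthonormal_basis (D : pred nat) (phi : nat -> H) : Prop :=
  (forall i j, D i -> D j -> [<phi i, phi j>] = (i == j)%:R) /\
  (forall x, (forall k, D k -> [<x, phi k>] = 0) -> x = 0).

Definition self_adjoint (A : H -> H) : Prop :=
  forall x y, [<A x, y>] = [<x, A y>].

Definition compact_operator (A : H -> H) : Prop :=
  precompact (A @` [set x | `|x| <= 1]).

(* A = \sum_k lam k phi_k (x) phi_k *)
Definition spectral_expansion (D : pred nat) (phi : nat -> H)
    (lam : nat -> R) (A : H -> H) : Prop :=
  (forall k, D k -> A (phi k) = lam k *: phi k) /\
  (forall f, is_sum D (fun k => (lam k * [<f, phi k>]) *: phi k) (A f)).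

End HilbertDefs.

(* H with its Borel sigma-algebra *)
Notation borel H := (g_sigma_algebraType (@open H)).

Section Expectations.
Context (d : measure_display) (T : measurableType d) (R : realType).
Context (P : probability T R) (H : hilbertType R).

Definition expec (Z : T -> R) : R := fine 'E_P[Z].

Definition random_element (Z : T -> H) : Prop :=
  measurable_fun [set: T] (Z : T -> borel H).

Definition integrableR (Z : T -> R) : Prop :=
  P.-integrable [set: T] (EFin \o Z).

Definition integrableH (Z : T -> H) : Prop :=
  random_element Z /\ integrableR (fun w => `|Z w|).

(* The expectation of an H-valued random element: the e with
   <e, f> = E <Z, f> for all f.  For separable H and Z satisfying integrableH,
   e exists, is unique, and is the Bochner integral of Z; otherwise the value
   is irrelevant. *)
Definition expecH (Z : T -> H) : H :=
  xget 0 [set e | forall f : H, [<e, f>] = expec (fun w => [<Z w, f>])].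

(* g is a version of x |-> E [Z | X = x] *)
Definition cond_expecR (X : T -> H) (Z : T -> R) (g : borel H -> R) : Prop :=
  [/\ integrableR Z, measurable_fun [set: borel H] g,
      integrableR (fun w => g (X w)) &
      forall B : set (borel H), measurable B ->
        expec (fun w => \1_B (X w) * Z w) =
        expec (fun w => \1_B (X w) * g (X w))].

Definition cond_expecH (X Z : T -> H) (g : borel H -> H) : Prop :=
  [/\ integrableH Z, measurable_fun [set: borel H] (g : borel H -> borel H),
      integrableH (fun w => g (X w)) &
      forall B : set (borel H), measurable B ->
        expecH (fun w => (\1_B (X w) : R) *: Z w) =
        expecH (fun w => (\1_B (X w) : R) *: g (X w))].

End Expectations.

Section Kernel.
Context (R : realType).

Definition probability_density (K : R -> R) : Prop :=
  [/\ measurable_fun [set: R] K, forall u, 0 <= K u &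
      (\int[lebesgue_measure]_u (K u)%:E = 1)%E].

Definition scaled_kernel (K : R -> R) (b u : R) : R := b^-1 * K (u / b).

End Kernel.

Section LocalLinear.
Context (d : measure_display) (T : measurableType d) (R : realType).
Context (P : probability T R) (H : hilbertType R).
(* W is the random weight K_B(|X - x0|). *)
Context (W : T -> R) (X Y : T -> H) (x0 : H).

Definition local_loss (b0 : H) (b1 : H -> H) : R :=
  expec P (fun w => `|Y w - b0 - b1 (X w - x0)| ^+ 2 * W w).

Definition loss_minimizer (b0 : H) (b1 : H -> H) : Prop :=
  forall (c0 : H) (c1 : {linear H -> H}), continuous c1 ->
    local_loss b0 b1 <= local_loss c0 c1.

(* The derivatives of the loss with respect to beta_0, in H, and with respect
   to beta_1, in the space of bounded operators, vanish in every direction. *)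
Definition loss_stationary (b0 : H) (b1 : H -> H) : Prop :=
  (forall h : H, 'D_h (fun b => local_loss b b1) b0 = 0) /\
  (forall B : {linear H -> H}, continuous B ->
     derive1 (fun t : R => local_loss b0 (fun x => b1 x + t *: B x)) 0 = 0).

Definition normal_eq0 (b0 : H) (b1 : H -> H) : Prop :=
  expecH P (fun w => W w *: (b0 - Y w + b1 (X w - x0))) = 0.

Definition normal_eq1 (b0 : H) (b1 : H -> H) : Prop :=
  expec P (fun w => W w * ([<b1 (X w - x0), X w - x0>]
                           - [<Y w - b0, X w - x0>])) = 0.

End LocalLinear.

(* Main.v *)
(* A Frechet derivative A that is the same at every point makes m affine, m x = m x0 + A (x - x0),
   so Y - m x0 - A (X - x0) is the error term.  Its conditional mean is zero, hence it is orthogonal,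
   for the bilinear form E [W <U, V>], to every function of X with finite weighted second moment.
   This is stationarity of the loss at (m x0, A), and, tested against <X - x0, phi_k> phi_k, it
   identifies the estimated eigenvalues with those of A and the predictor with m x0; that is why the
   estimated operator is bounded and the predictor series converges.  The loss is a quadratic
   polynomial along every line, which gives its derivatives, and all series are the Parseval expansion
   of the same bilinear form, exchanged with the expectation by dominated convergence. *)
Require Import Defs.
From HB Require Import structures.
From mathcomp Require Import all_boot all_order all_algebra.
From mathcomp Require Import all_classical all_reals all_analysis measurable_realfun.
From mathcomp Require Import ring lra.
Import Order.TTheory GRing.Theory Num.Theory.
Import numFieldNormedType.Exports.
Local Open Scope classical_set_scope.
Local Open Scope ring_scope.

(** * Hilbert spaces and orthonormal bases *)

Lemma is_sum_unique {R : realType} {V : normedModType R} {D : pred nat}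
    {u : nat -> V} {s t : V} :
  is_sum D u s -> is_sum D u t -> s = t.
Proof. by move=> us ut; apply: cvg_unique us ut; exact: norm_hausdorff. Qed.

Lemma eq_is_sum {R : realType} {V : normedModType R} {D : pred nat}
    {u v : nat -> V} {s : V} :
  (forall k, D k -> u k = v k) -> is_sum D u s -> is_sum D v s.
Proof.
by move=> uv; rewrite /is_sum; under eq_fun do under eq_bigr do rewrite uv//.
Qed.

Section Inner.
Context {R : realType} {H : hilbertType R}.
Implicit Types (x y z : H) (a : R).

Lemma innerDr x y z : [<x, y + z>] = [<x, y>] + [<x, z>].
Proof. by rewrite innerC innerDl !(innerC x). Qed.

Lemma innerZr a x y : [<x, a *: y>] = a * [<x, y>].
Proof. by rewrite innerC innerZl innerC. Qed.

Lemma inner0l x : [<0, x>] = 0.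
Proof. by rewrite -(scale0r (0 : H)) innerZl mul0r. Qed.

Lemma inner0r x : [<x, 0>] = 0.
Proof. by rewrite innerC inner0l. Qed.

Lemma innerNl x y : [<- x, y>] = - [<x, y>].
Proof. by rewrite -scaleN1r innerZl mulN1r. Qed.

Lemma innerNr x y : [<x, - y>] = - [<x, y>].
Proof. by rewrite innerC innerNl innerC. Qed.

Lemma innerBl x y z : [<x - y, z>] = [<x, z>] - [<y, z>].
Proof. by rewrite innerDl innerNl. Qed.

Lemma innerBr x y z : [<x, y - z>] = [<x, y>] - [<x, z>].
Proof. by rewrite innerDr innerNr. Qed.

Lemma inner_suml (I : Type) (r : seq I) (P : pred I) (F : I -> H) y :
  [<\sum_(i <- r | P i) F i, y>] = \sum_(i <- r | P i) [<F i, y>].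
Proof.
by elim/big_rec2 : _ => [|i u v _ <-]; rewrite ?inner0l// innerDl.
Qed.

Lemma inner_sumr (I : Type) (r : seq I) (P : pred I) (F : I -> H) y :
  [<y, \sum_(i <- r | P i) F i>] = \sum_(i <- r | P i) [<y, F i>].
Proof. by rewrite innerC inner_suml; apply: eq_bigr => i _; rewrite innerC. Qed.

Lemma cauchy_schwarz x y : `|[<x, y>]| <= `|x| * `|y|.
Proof.
have [->|y0] := eqVneq y 0; first by rewrite inner0r normr0 mulr_ge0.
have yy : 0 < `|y| ^+ 2 by rewrite exprn_gt0// normr_gt0.
rewrite -ler_sqr ?nnegrE ?mulr_ge0// real_normK ?num_real// exprMn.
(* The squared norm of this vector is [|y|^2 * (|x|^2 * |y|^2 - <x, y>^2)]. *)
have := sqr_ge0 `| `|y| ^+ 2 *: x - [<x, y>] *: y|.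
rewrite -inner_norm !(innerBl, innerBr, innerZl, innerZr) (innerC y x) !inner_norm.
move=> h; rewrite -subr_ge0 -(pmulr_rge0 _ yy).
by move: h; congr (_ <= _); ring.
Qed.

Lemma inner_ext x y : (forall z, [<x, z>] = [<y, z>]) -> x = y.
Proof.
move=> xy; apply/eqP; rewrite -subr_eq0 -normr_eq0 -sqrf_eq0 -inner_norm.
by rewrite innerBl xy subrr.
Qed.

Lemma inner_continuousl y : continuous (fun x => [<x, y>]).
Proof.
move=> x; apply/cvgrPdist_lt => e e0; near=> z.
rewrite -innerBl (le_lt_trans (cauchy_schwarz _ _))//.
(* The added 1 keeps the divisor positive when [y = 0]. *)
have y0 : 0 < `|y| + 1 by rewrite ltr_wpDl.
apply: (@le_lt_trans _ _ (`|x - z| * (`|y| + 1))).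
  by rewrite ler_wpM2l// lerDl.
rewrite -ltr_pdivlMr//; near: z.
by apply: cvgr_dist_lt => //; rewrite divr_gt0.
Unshelve. all: by end_near. Qed.

Lemma is_sum_inner {D : pred nat} {u : nat -> H} {s : H} (y : H) :
  is_sum D u s -> is_sum D (fun k => [<u k, y>]) [<s, y>].
Proof.
move=> us; rewrite /is_sum; under eq_fun do rewrite -inner_suml.
exact: cvg_comp us (inner_continuousl y s).
Qed.

End Inner.

Section Basis.
Context {R : realType} {H : hilbertType R} {D : pred nat} {phi : nat -> H}.
Hypothesis phiB : orthonormal_basis D phi.
Implicit Types (x y z : H) (c : nat -> R).

Lemma inner_basis i j : D i -> D j -> [<phi i, phi j>] = (i == j)%:R.
Proof. by case: phiB => h _; exact: h. Qed.

Lemma basis_ext x y :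
  (forall k, D k -> [<x, phi k>] = [<y, phi k>]) -> x = y.
Proof.
case: phiB => _ h xy; apply/eqP; rewrite -subr_eq0; apply/eqP; apply: h => k Dk.
by rewrite innerBl xy// subrr.
Qed.

Lemma coef_partial_sum c n j : D j ->
  [<\sum_(k < n | D k) c k *: phi k, phi j>] = if (j < n)%N then c j else 0.
Proof.
move=> Dj; elim: n => [|n IH]; first by rewrite big_ord0 inner0l.
rewrite big_mkcond big_ord_recr/= -big_mkcond innerDl IH.
have [jn|jn] := eqVneq j n.
  by rewrite -jn Dj innerZl inner_basis// eqxx ltnn ltnSn mulr1 add0r.
rewrite [in RHS]ltnS [in RHS]leq_eqVlt (negPf jn)/=.
case: (ifP (D n)) => Dn; last by rewrite inner0l addr0.
by rewrite innerZl inner_basis// eq_sym (negPf jn) mulr0 addr0.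
Qed.

(** Orthonormality gives [|s n - s (n + p)|^2 = q (n + p) - q n], where [q] is nondecreasing and
    bounded by [M], so [s] is Cauchy and completeness provides the limit. Its [k]-th coefficient is
    that of every partial sum beyond [k]. *)
Lemma riesz_fischer {c} {M : R} :
  (forall n, \sum_(k < n | D k) c k ^+ 2 <= M) ->
  exists2 e : H, is_sum D (fun k => c k *: phi k) e &
    forall k, D k -> [<e, phi k>] = c k.
Proof.
move=> cM.
pose s n := \sum_(k < n | D k) c k *: phi k.
pose q n := \sum_(k < n | D k) c k ^+ 2.
have sq n p : [<s n, s (n + p)%N>] = q n.
  rewrite /s inner_suml; apply: eq_bigr => i Di.
  rewrite innerZl innerC coef_partial_sum//.
  by rewrite (ltn_addr p) ?ltn_ord// expr2.
have sdist n p : `|s n - s (n + p)%N| ^+ 2 = q (n + p)%N - q n.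
  have sqq m : [<s m, s m>] = q m by rewrite -{2}(addn0 m) sq.
  by rewrite -inner_norm !(innerBl, innerBr) (innerC (s (n + p)%N) (s n)) sq !sqq; ring.
have qcvg : cvgn q.
  apply: nondecreasing_is_cvgn.
    apply/nondecreasing_seqP => n.
    rewrite /q [leRHS]big_mkcond big_ord_recr/= -big_mkcond lerDl.
    by case: ifP => // _; exact: sqr_ge0.
  by exists M => _ [n _ <-]; exact: cM.
have scvg : cvgn s.
  apply: cauchy_cvg; apply/cauchy_exP => e e0.
  (* Both [q N] and [q n] lie within [e^2 / 2] of the limit of [q], so they differ by less than
     [e^2]. *)
  have e20 : 0 < e ^+ 2 / 2 by rewrite divr_gt0// exprn_gt0.
  have /cvgrPdist_lt/(_ _ e20)[N _ hN] := qcvg.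
  exists (s N), N => // n /= Nn.
  rewrite -ball_normE /ball_/= -(subnKC Nn).
  rewrite -ltr_sqr ?nnegrE// ?(ltW e0)// sdist subnKC//.
  have := hN n Nn; have := hN N (leqnn N).
  rewrite !ltr_norml => /andP[? ?] /andP[? ?]; lra.
exists (lim (s @ \oo)) => // k Dk.
have h : is_sum D (fun k => c k *: phi k) (lim (s @ \oo)) by exact: scvg.
move: (is_sum_inner (phi k) h) => /is_sum_unique; apply.
apply: cvg_near_cst; exists k.+1 => // n /= kn; apply/eqP.
by rewrite -inner_suml coef_partial_sum// kn.
Qed.

(** Expanding [0 <= |x - s|^2] bounds the sums of squared coefficients by [|x|^2]. Riesz-Fischer
    then yields a vector [e] with the coefficients of [x], and completeness of the basis forces
    [e = x]. *)
Lemma basis_expansion x : is_sum D (fun k => [<x, phi k>] *: phi k) x.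
Proof.
have [|e es ec] := @riesz_fischer (fun k => [<x, phi k>]) (`|x| ^+ 2).
  move=> n; pose s := \sum_(k < n | D k) [<x, phi k>] *: phi k.
  have ss : [<s, s>] = [<x, s>].
    rewrite {1}/s inner_suml /s inner_sumr; apply: eq_bigr => i Di.
    rewrite innerZl (innerC (phi i)) (coef_partial_sum (fun k => [<x, phi k>]))//.
    by rewrite ltn_ord innerZr.
  have <- : [<x, s>] = \sum_(k < n | D k) [<x, phi k>] ^+ 2.
    by rewrite inner_sumr; apply: eq_bigr => i Di; rewrite innerZr expr2.
  have := sqr_ge0 `|x - s|.
  by rewrite -!inner_norm !(innerBl, innerBr) (innerC s x) ss; lra.
have xe : x = e by apply: basis_ext => k Dk; rewrite ec.
by rewrite [X in is_sum _ _ X]xe.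
Qed.

Lemma parseval x y : is_sum D (fun k => [<x, phi k>] * [<y, phi k>]) [<x, y>].
Proof.
move: (is_sum_inner y (basis_expansion x)); apply: eq_is_sum => k Dk.
by rewrite innerZl (innerC y).
Qed.

Lemma bessel x n : \sum_(k < n | D k) [<x, phi k>] ^+ 2 <= `|x| ^+ 2.
Proof.
rewrite -inner_norm.
have xs := parseval x x; rewrite -(cvg_lim _ xs)//.
under eq_bigr do rewrite expr2.
apply: (nondecreasing_cvgn_le _ _ n); last by apply/cvg_ex; exists [<x, x>].
apply/nondecreasing_seqP => m.
rewrite [leRHS]big_mkcond big_ord_recr/= -big_mkcond lerDl.
by case: ifP => // _; rewrite -expr2 sqr_ge0.
Qed.

(** This bound, uniform in [n], is the domination used to exchange Parseval series with
    expectations. The partial sum is [<s, y>] for the projection [s] of [x], and [|s| <= |x|] by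
    Bessel. *)
Lemma partial_parseval_le x y n :
  `|\sum_(k < n | D k) [<x, phi k>] * [<y, phi k>]| <= `|x| * `|y|.
Proof.
pose s := \sum_(k < n | D k) [<x, phi k>] *: phi k.
have <- : [<s, y>] = \sum_(k < n | D k) [<x, phi k>] * [<y, phi k>].
  by rewrite inner_suml; apply: eq_bigr => k _; rewrite innerZl (innerC y).
apply: (le_trans (cauchy_schwarz _ _)); rewrite ler_wpM2r//.
rewrite -ler_sqr ?nnegrE// -inner_norm {1}/s inner_suml.
apply: le_trans (bessel x n); apply: ler_sum => k Dk.
rewrite innerZl (innerC (phi _)) (coef_partial_sum (fun k => [<x, phi k>]))//.
by rewrite ltn_ord expr2.
Qed.

Lemma spectral_coef {l : nat -> R} {A : H -> H} x {k} :
  spectral_expansion D phi l A -> D k -> [<A x, phi k>] = l k * [<x, phi k>].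
Proof.
move=> [_ As] Dk; move: (is_sum_inner (phi k) (As x)) => /is_sum_unique; apply.
apply: cvg_near_cst; exists k.+1 => // n /= kn; apply/eqP.
by rewrite -inner_suml (coef_partial_sum (fun j => l j * [<x, phi j>]))// kn.
Qed.

End Basis.

(** * Expectations *)

Section Expectation.
Context {d : measure_display} {T : measurableType d} {R : realType}.
Context {P : probability T R}.
Implicit Types f g : T -> R.

Lemma expecE f : expec P f = \int[P]_w f w.
Proof. by rewrite /expec unlock. Qed.

Lemma eq_expec {f g} : (forall w, f w = g w) -> expec P f = expec P g.
Proof. by move=> fg; congr expec; exact: funext. Qed.

Lemma eq_integrableR {f g} :
  (forall w, f w = g w) -> integrableR P f -> integrableR P g.
Proof. by move=> fg; rewrite (_ : f = g)//; exact: funext. Qed.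

Lemma integrableR_measurable {f} : integrableR P f -> measurable_fun [set: T] f.
Proof. by move=> /measurable_int/measurable_EFinP. Qed.

Lemma integrableRD {f g} : integrableR P f -> integrableR P g ->
  integrableR P (fun w => f w + g w).
Proof. by move=> fi gi; exact: (integrableD measurableT fi gi). Qed.

Lemma integrableRZ (a : R) {f} : integrableR P f ->
  integrableR P (fun w => a * f w).
Proof. by move=> fi; exact: (integrableZl measurableT a fi). Qed.

Lemma integrableRB {f g} : integrableR P f -> integrableR P g ->
  integrableR P (fun w => f w - g w).
Proof. by move=> fi gi; exact: (integrableB measurableT fi gi). Qed.

Lemma integrableR_le {f g} : measurable_fun [set: T] f ->
  (forall w, `|f w| <= g w) -> integrableR P g -> integrableR P f.
Proof.
move=> mf fg; apply: le_integrable => //; first exact/measurable_EFinP.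
by move=> w _; rewrite /= lee_fin (le_trans (fg w))// ler_norm.
Qed.

Lemma integrableR_norm {f} : integrableR P f -> integrableR P (fun w => `|f w|).
Proof. exact: integrable_norm. Qed.

Lemma expecD {f g} : integrableR P f -> integrableR P g ->
  expec P (fun w => f w + g w) = expec P f + expec P g.
Proof. by move=> fi gi; rewrite !expecE RintegralD. Qed.

Lemma expecB {f g} : integrableR P f -> integrableR P g ->
  expec P (fun w => f w - g w) = expec P f - expec P g.
Proof. by move=> fi gi; rewrite !expecE RintegralB. Qed.

Lemma expecZ (a : R) {f} : integrableR P f ->
  expec P (fun w => a * f w) = a * expec P f.
Proof. by move=> fi; rewrite !expecE RintegralZl. Qed.

Lemma expec0 : expec P (fun=> 0) = 0.
Proof. by rewrite expecE /Rintegral integral0. Qed.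

Lemma expec_le {f g} : integrableR P f -> integrableR P g ->
  (forall w, f w <= g w) -> expec P f <= expec P g.
Proof. by move=> fi gi fg; rewrite !expecE; apply: le_Rintegral. Qed.

(** Both conclusions go through one induction, since additivity at each step needs the tail to be
    integrable. *)
Lemma integrableR_expec_sum {I : Type} (s : seq I) {Q : pred I} {f : I -> T -> R} :
  (forall i, Q i -> integrableR P (f i)) ->
  integrableR P (fun w => \sum_(i <- s | Q i) f i w) /\
  expec P (fun w => \sum_(i <- s | Q i) f i w) =
    \sum_(i <- s | Q i) expec P (f i).
Proof.
move=> fi; elim: s => [|i s [IHi IHe]].
  rewrite big_nil; split.
    apply: (@eq_integrableR (fun=> 0)); last exact: integrable0.
    by move=> w; rewrite big_nil.
  by rewrite -[RHS]expec0; apply: eq_expec => w; rewrite big_nil.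
rewrite big_cons; case: ifPn => Qi; last first.
  split; first by apply: eq_integrableR IHi => w; rewrite big_cons (negPf Qi).
  by rewrite -IHe; apply: eq_expec => w; rewrite big_cons (negPf Qi).
split.
  apply: eq_integrableR (integrableRD (fi _ Qi) IHi) => w.
  by rewrite big_cons Qi.
rewrite -IHe -expecD//; last exact: fi.
by apply: eq_expec => w; rewrite big_cons Qi.
Qed.

Lemma expec_dominated_cvg {F : nat -> T -> R} {f} g :
  (forall n, measurable_fun [set: T] (F n)) ->
  (forall w, F n w @[n --> \oo] --> f w) ->
  (forall n w, `|F n w| <= g w) -> integrableR P g ->
  expec P (F n) @[n --> \oo] --> expec P f.
Proof.
move=> mF Ff Fg gi.
have mf : measurable_fun [set: T] f.
  by apply: (measurable_fun_cvg mF) => w _; exact: Ff.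
(* The limit inherits the bound [g], so its expectation is finite and taking [fine] loses
   nothing. *)
have fi : integrableR P f.
  apply: integrableR_le gi => // w.
  rewrite -(cvg_lim _ (cvg_norm (Ff w)))//.
  apply: limr_le; first exact: cvgP (cvg_norm (Ff w)).
  by near=> n; exact: Fg.
have := @dominated_cvg _ _ _ P setT measurableT (fun n w => (F n w)%:E)
  (EFin \o f) (EFin \o g).
move=> h.
rewrite expecE; under eq_fun do rewrite expecE.
apply/fine_cvg.
rewrite fineK; last exact: integrable_fin_num.
apply: h => //.
- by move=> n; exact/measurable_EFinP.
- move=> w _ /=; apply/fine_cvgP; split; first by near=> n.
  exact: Ff.
- by move=> n w _; rewrite /= lee_fin.
Unshelve. all: by end_near. Qed.

Lemma expec_ae {f g} : measurable_fun [set: T] f -> measurable_fun [set: T] g ->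
  {ae P, forall w, f w = g w} -> expec P f = expec P g.
Proof.
move=> mf mg fg; rewrite !expecE /Rintegral; congr fine.
apply: ae_eq_integral => //; try exact/measurable_EFinP.
by apply: filterS fg => w /= ->.
Qed.

Lemma integrableR_ae {f g} : measurable_fun [set: T] g ->
  {ae P, forall w, f w = g w} -> integrableR P f -> integrableR P g.
Proof.
move=> mg fg fi; have mf := integrableR_measurable fi.
have mnorm (h : T -> R) : measurable_fun [set: T] h ->
    measurable_fun [set: T] (fun w => `|(h w)%:E|%E).
  by move=> mh; apply: measurableT_comp => //; exact/measurable_EFinP.
apply/integrableP; split; first exact/measurable_EFinP.
have /integrableP[_] := fi; apply: le_lt_trans.
rewrite (@ae_eq_integral _ _ _ _ _ (fun w => `|(f w)%:E|%E))//; try exact: mnorm.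
by apply: filterS fg => w /= ->.
Qed.

End Expectation.

(** * Orthogonality to functions of the conditioning variable *)

Section ConditionalOrthogonality.
Import HBNNSimple.
Context {d d' : measure_display} {T : measurableType d} {S : measurableType d'}.
Context {R : realType} {P : probability T R}.
Context {X : T -> S} {Z : T -> R}.
Hypothesis mX : measurable_fun [set: T] X.
Hypothesis Zi : integrableR P Z.
Hypothesis ZX0 : forall B : set S, measurable B ->
  expec P (fun w => \1_B (X w) * Z w) = 0.

(** [ZX0] and linearity give the claim for simple functions. The increasing simple approximations
    [s n] of [g] satisfy [|s n (X) * Z| <= |g (X) * Z|], so dominated convergence carries it to
    [g]. *)
Lemma expec_ge0_measurable_mul0 {g : S -> R} :
  measurable_fun [set: S] g -> (forall x, 0 <= g x) ->
  integrableR P (fun w => g (X w) * Z w) ->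
  expec P (fun w => g (X w) * Z w) = 0.
Proof.
move=> mg g0 gZ.
have mg' : measurable_fun [set: S] (EFin \o g) by exact/measurable_EFinP.
pose s n := nnsfun_approx measurableT mg' n.
have sg x : s n x @[n --> \oo] --> g x.
  have g0' y : [set: S] y -> (0 <= (EFin \o g) y)%E by rewrite lee_fin.
  by have /fine_cvgP[_] := cvg_nnsfun_approx measurableT mg' g0' I (x := x).
have sle n x : s n x <= g x.
  rewrite -(cvg_lim _ (sg x))//.
  apply: (@nondecreasing_cvgn_le _ (fun n => s n x) _ _ n).
    by move=> p q pq; exact/lefP/nd_nnsfun_approx.
  by apply/cvg_ex; exists (g x).
have mZ := integrableR_measurable Zi.
have msZ n : measurable_fun [set: T] (fun w => s n (X w) * Z w).
  by apply: measurable_funM => //; apply: measurableT_comp => //; exact: measurable_funP.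
have sZ0 n : expec P (fun w => s n (X w) * Z w) = 0.
  (* Split over the finitely many values of [s n]: [h y] is the contribution of the level set of
     [y]. *)
  pose r := finmap.enum_fset (fset_set (range (s n))).
  pose h y w := y * (\1_(s n @^-1` [set y]) (X w) * Z w).
  have iB B : measurable B -> integrableR P (fun w => \1_B (X w) * Z w).
    move=> mB; apply: integrableR_le (integrableR_norm Zi).
    - apply: measurable_funM => //; apply: measurableT_comp => //.
    - move=> w /=; rewrite normrM ler_piMl// indicE.
      by case: (_ \in _); rewrite ?normr1 ?normr0.
  have mpre y : measurable (s n @^-1` [set y]) by exact: measurable_funPTI.
  have [|_ hs] := @integrableR_expec_sum _ _ _ P _ r xpredT h.
    by move=> y _; apply/integrableRZ/iB/mpre.
  transitivity (expec P (fun w => \sum_(y <- r) h y w)).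
    apply: eq_expec => w; rewrite fimfunE fsbig_finite/=; last exact: fimfunP.
    by rewrite mulr_suml; apply: eq_bigr => y _; rewrite /h mulrA.
  rewrite hs big1// => y _; rewrite expecZ; last exact/iB/mpre.
  by rewrite ZX0 ?mulr0//; exact: mpre.
have : expec P (fun w => s n (X w) * Z w) @[n --> \oo] -->
       expec P (fun w => g (X w) * Z w).
  apply: expec_dominated_cvg _ _ _ _ (integrableR_norm gZ) => //.
  - by move=> w; apply: cvgMl; exact: sg.
  - move=> n w /=; rewrite !normrM ler_wpM2r// !ger0_norm//.
under eq_fun do rewrite sZ0.
by move/cvg_lim => <-//; rewrite lim_cst.
Unshelve. all: by end_near. Qed.

(** Apply the nonnegative case to the positive and negative parts of [g]; both are bounded by [|g|],
    so their products with [Z] stay integrable. *)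
Lemma expec_measurable_mul0 {g : S -> R} : measurable_fun [set: S] g ->
  integrableR P (fun w => g (X w) * Z w) ->
  expec P (fun w => g (X w) * Z w) = 0.
Proof.
move=> mg gZ.
have mZ := integrableR_measurable Zi.
have gle (f : S -> R) : measurable_fun [set: S] f -> (forall x, `|f x| <= `|g x|) ->
    integrableR P (fun w => f (X w) * Z w).
  move=> mf fg; apply: integrableR_le (integrableR_norm gZ).
    by apply: measurable_funM => //; exact: measurableT_comp.
  by move=> w /=; rewrite !normrM ler_wpM2r.
have mp : measurable_fun [set: S] (fun x => Num.max (g x) 0).
  exact: measurable_maxr.
have mn : measurable_fun [set: S] (fun x => Num.max (- g x) 0).
  by apply: measurable_maxr => //; exact: measurableT_comp.
have ip : integrableR P (fun w => Num.max (g (X w)) 0 * Z w).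
  by apply: (gle _ mp) => x; case: (leP (g x)) => h; rewrite ?normr0.
have im : integrableR P (fun w => Num.max (- g (X w)) 0 * Z w).
  by apply: (gle _ mn) => x; case: (leP (- g x)) => h; rewrite ?normr0 ?normrN.
have ep : expec P (fun w => Num.max (g (X w)) 0 * Z w) = 0.
  by apply: (expec_ge0_measurable_mul0 mp) => // x; rewrite le_max lexx orbT.
have em : expec P (fun w => Num.max (- g (X w)) 0 * Z w) = 0.
  by apply: (expec_ge0_measurable_mul0 mn) => // x; rewrite le_max lexx orbT.
have := expecB ip im; rewrite ep em subrr => <-; apply: eq_expec => w.
rewrite -mulrBl; congr (_ * _).
by case: (leP (g _)) => h; case: (leP (- g _)) => h'; lra.
Qed.

End ConditionalOrthogonality.

(** * Quadratic polynomials along lines, and maps with constant derivative *)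

Section Quadratic.
Context {R : realType}.

(** Away from [t = 0] the difference quotient is [p + t * q]. With [V] equal to [R] and [h = 1] this
    also covers the ordinary derivative. *)
Lemma is_derive_quadratic {V : normedModType R} {f : V -> R} {b h : V} {p : R}
    (q : R) :
  (forall t : R, f (t *: h + b) = f b + t * p + t ^+ 2 * q) ->
  is_derive b h f p.
Proof.
move=> fE.
have : (fun t : R => t^-1 *: ((f \o shift b) (t *: h) - f b)) @ 0^' --> p.
  apply: (@cvg_trans _ ((fun t : R => p + t * q) @ 0^')).
    apply: near_eq_cvg; near=> t.
    have t0 : t != 0 by near: t; exact: nbhs_dnbhs_neq.
    by rewrite /= fE /GRing.scale/=; by field.
  have : (fun t : R => p + t * q) @ 0^' --> p + 0 * q.
    by apply: cvgD; [exact: cvg_cst|apply: cvgMl; exact: nbhs_dnbhs].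
  by rewrite mul0r addr0.
move=> fp; split; first by apply/cvg_ex; exists p.
exact: cvg_lim fp.
Unshelve. all: by end_near. Qed.

Lemma quadratic_min {p q : R} :
  (forall t : R, 0 <= t * p + t ^+ 2 * q) -> p = 0.
Proof.
(* At [t = - p / (|q| + 1)] the polynomial is a nonpositive multiple of [p^2], because [|q| + 1 - q]
   is positive; hence [p^2 <= 0]. *)
move=> h; have r0 : 0 < `|q| + 1 by rewrite ltr_wpDl.
have qr := ler_norm q; have := h (- p / (`|q| + 1)).
have -> : - p / (`|q| + 1) * p + (- p / (`|q| + 1)) ^+ 2 * q =
  - (p ^+ 2 * (`|q| + 1 - q)) / (`|q| + 1) ^+ 2 by field; rewrite lt0r_neq0.
rewrite pmulr_lge0 ?invr_gt0 ?exprn_gt0// oppr_ge0 pmulr_lle0; last by lra.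
by move=> p0; apply/eqP; rewrite -sqrf_eq0 eq_le p0 sqr_ge0.
Qed.

End Quadratic.

(** Subtracting the linear part along the line from [x0] to [x] leaves a function with zero
    derivative. Pairing with an arbitrary [f] makes it real-valued, hence constant, and its values
    at 0 and 1 give the formula. *)
Lemma affine_of_diff_const {R : realType} {H : hilbertType R} {m : H -> H}
    {A : {linear H -> H}} :
  (forall x : H, is_diff x m A) -> forall x0 x, m x = m x0 + A (x - x0).
Proof.
move=> mA x0 x; apply: inner_ext => f.
pose v := x - x0.
pose g (t : R) := [<m (t *: v + x0) - t *: A v, f>].
have gd (t : R) : is_derive t (1 : R) g 0.
  pose y := t *: v + x0.
  have my : (fun s : R => s^-1 *: ((m \o shift y) (s *: v) - m y)) @ 0^' --> A v.
    have [dm dmA] := mA y; have : derivable m y v by exact: diff_derivable.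
    have <- : 'D_v m y = A v by rewrite deriveE// dmA.
    by [].
  have : (fun s : R => s^-1 *: ((g \o shift t) (s *: (1 : R)) - g t)) @ 0^' --> (0 : R).
    have := cvg_comp _ _ my (inner_continuousl f (A v)).
    move=> h0; have h := cvgB h0 (cvg_cst [<A v, f>]).
    rewrite subrr in h.
    apply: (@cvg_trans _ ((fun s : R =>
      [<s^-1 *: (m (s *: v + y) - m y), f>] - [<A v, f>]) @ 0^')); last exact: h.
    apply: near_eq_cvg; near=> s.
    have s0 : s != 0 by near: s; exact: nbhs_dnbhs_neq.
    have -> : g t = [<m y - t *: A v, f>] by [].
    rewrite /g /= scaler1 scalerDl -addrA -/y.
    rewrite !(innerBl, innerDl, innerZl, innerNl) /GRing.scale/=; by field.
  move=> fp; split; first by apply/cvg_ex; exists 0.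
  exact: cvg_lim fp.
have := is_derive_0_is_cst 1 0 gd.
rewrite /g /v !scale1r !scale0r subr0 add0r subrK => e.
by rewrite innerDl -e innerBl subrK.
Unshelve. all: by end_near. Qed.

(** * Hilbert-valued random elements *)

Section RandomElements.
Context {d : measure_display} {T : measurableType d} {R : realType}.
Context {P : probability T R} {H : hilbertType R}.

Lemma continuous_measurable_borel {f : H -> R} :
  continuous f -> measurable_fun [set: borel H] f.
Proof.
move=> cf; apply: (measurability (@RGenOpens.G R)).
  exact: RGenOpens.measurableE.
move=> _ [_ [x [y ->]] <-]; rewrite setTI.
apply: sub_sigma_algebra; apply: open_comp => [z _|]; first exact: cf.
exact: interval_open.
Qed.

(** Testing against vectors reduces sums and scalar multiples to real-valued measurability; Borel
    random elements have this property by [weakly_measurable_comp]. *)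
Definition weakly_measurable (U : T -> H) : Prop :=
  forall f : H, measurable_fun [set: T] (fun w => [<U w, f>]).

Lemma weakly_measurable_comp {Z : T -> H} {g : H -> H} :
  random_element Z -> continuous g -> weakly_measurable (g \o Z).
Proof.
move=> rZ cg f.
apply: (@measurableT_comp _ _ _ _ _ _ (fun x : borel H => [<g x, f>])) rZ.
apply: continuous_measurable_borel => x.
exact: cvg_comp (cg x) (inner_continuousl f (g x)).
Qed.

Lemma weakly_measurable_cst (a : H) : weakly_measurable (fun=> a).
Proof. by move=> f; exact: measurable_cst. Qed.

Lemma weakly_measurableD {U V : T -> H} : weakly_measurable U ->
  weakly_measurable V -> weakly_measurable (fun w => U w + V w).
Proof.
move=> mU mV f; under eq_fun do rewrite innerDl.
exact: measurable_funD.
Qed.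

Lemma weakly_measurableZ {g : T -> R} {U : T -> H} :
  measurable_fun [set: T] g -> weakly_measurable U ->
  weakly_measurable (fun w => g w *: U w).
Proof.
move=> mg mU f; under eq_fun do rewrite innerZl.
exact: measurable_funM.
Qed.

Context {D : pred nat} {phi : nat -> H}.
Hypothesis phiB : orthonormal_basis D phi.

(** By Parseval the inner product is a pointwise limit of finite sums of products of measurable
    coordinates. *)
Lemma measurable_inner {U V : T -> H} : weakly_measurable U ->
  weakly_measurable V -> measurable_fun [set: T] (fun w => [<U w, V w>]).
Proof.
move=> mU mV.
apply: (@measurable_fun_cvg _ _ _ _ (fun n w =>
  \sum_(k < n | D k) [<U w, phi k>] * [<V w, phi k>])).
  move=> n; under eq_fun do rewrite big_mkcond.
  apply: measurable_sum => k; case: (D k); last exact: measurable_cst.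
  exact: measurable_funM.
by move=> w _; exact: parseval.
Qed.

(** This shows that the vector sought in [expecH] exists. The numbers [c k] are the only possible
    coordinates; they are square-summable with bound [(E g)^2], so Riesz-Fischer produces [e], and
    Parseval with dominated convergence extends the identity from the basis to every [f]. *)
Lemma expecH_inner (Z : T -> H) (g : T -> R) : weakly_measurable Z ->
  (forall w, `|Z w| <= g w) -> integrableR P g ->
  forall f, [<expecH P Z, f>] = expec P (fun w => [<Z w, f>]).
Proof.
move=> mZ Zg gi.
have gi' (f : H) : integrableR P (fun w => `|f| * g w) by exact: integrableRZ.
have Zle f w : `|[<Z w, f>]| <= `|f| * g w.
  by rewrite (le_trans (cauchy_schwarz _ _))// mulrC ler_wpM2l.
have Zi f : integrableR P (fun w => [<Z w, f>]).
  exact: integrableR_le (mZ f) (Zle f) (gi' f).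
pose c k := expec P (fun w => [<Z w, phi k>]).
have Eg0 : 0 <= expec P g.
  rewrite -(expec0 (P := P)); apply: expec_le => //; first exact: integrable0.
  by move=> w; exact: le_trans (Zg w).
have Esum n : expec P (fun w => [<Z w, \sum_(k < n | D k) c k *: phi k>]) =
    \sum_(k < n | D k) c k ^+ 2.
  pose h (k : 'I_n) w := c k * [<Z w, phi k>].
  have [|_ hE] := @integrableR_expec_sum _ _ _ P _ (index_enum 'I_n)
      (fun k => D k) h.
    by move=> k _; exact: integrableRZ.
  transitivity (\sum_(k < n | D k) expec P (h k)).
    rewrite -hE; apply: eq_expec => w; rewrite inner_sumr.
    by apply: eq_bigr => k _; rewrite innerZr.
  by apply: eq_bigr => k _; rewrite expecZ// expr2.
(* Testing Z against the partial sum s of sum_k c_k phi_k gives |s|^2 <= |s| E g. *)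
have cM n : \sum_(k < n | D k) c k ^+ 2 <= expec P g ^+ 2.
  pose s := \sum_(k < n | D k) c k *: phi k.
  have s2 : \sum_(k < n | D k) c k ^+ 2 = `|s| ^+ 2.
    rewrite -inner_norm {1}/s inner_suml; apply: eq_bigr => k Dk.
    by rewrite innerZl innerC /s (coef_partial_sum phiB)// ltn_ord expr2.
  have : `|s| ^+ 2 <= `|s| * expec P g.
    rewrite -s2 -Esum -expecZ//; apply: expec_le => // w.
    by rewrite (le_trans (ler_norm _))// Zle.
  rewrite s2 expr2; have [->|s0] := eqVneq s 0.
    by rewrite normr0 mul0r sqr_ge0.
  rewrite ler_pM2l ?normr_gt0// => sg.
  by rewrite ler_sqr ?nnegrE.
have [e es ec] := riesz_fischer phiB cM.
have : exists e : H, forall f, [<e, f>] = expec P (fun w => [<Z w, f>]).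
  exists e => f.
  (* The partial Parseval sums of [<e, f>] are the expectations of those of [<Z, f>], which are
     dominated by [|f| * g]. *)
  pose F n w := \sum_(k < n | D k) [<Z w, phi k>] * [<f, phi k>].
  have FE n : expec P (F n) = \sum_(k < n | D k) [<e, phi k>] * [<f, phi k>].
    have [|_ ->] := @integrableR_expec_sum _ _ _ P _ (index_enum 'I_n)
      (fun k => D k) (fun k w => [<Z w, phi k>] * [<f, phi k>]).
      move=> k _; apply: eq_integrableR (integrableRZ [<f, phi k>] (Zi (phi k))) => w.
      by rewrite mulrC.
    apply: eq_bigr => k Dk; rewrite ec// /c mulrC -expecZ//.
    by apply: eq_expec => w; rewrite mulrC.
  have Fcvg : expec P (F n) @[n --> \oo] --> expec P (fun w => [<Z w, f>]).
    apply: (expec_dominated_cvg (fun w => `|f| * g w)) => //.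
    - move=> n; rewrite /F; under eq_fun do rewrite big_mkcond.
      apply: measurable_sum => k; case: (D k); last exact: measurable_cst.
      by apply: measurable_funM => //; exact: measurable_cst.
    - by move=> w; exact: parseval.
    - move=> n w; apply: le_trans (partial_parseval_le phiB _ _ _) _.
      by rewrite mulrC ler_wpM2l.
  apply: is_sum_unique (parseval phiB e f) _.
  by rewrite /is_sum; under eq_fun do rewrite -FE.
(* Existence rules out the default value 0 of [xget], and any vector it picks has the required
   property. *)
by move=> h; rewrite /expecH; case: xgetP => [x _ //|nh] f; case: h => y hy; case: (nh y).
Qed.

End RandomElements.

(** * Hilbert-valued maps that are square-integrable against a weight *)

Definition weighted_L2 {d : measure_display} {T : measurableType d}
    {R : realType} (P : probability T R) {H : hilbertType R} (W : T -> R)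
    (U : T -> H) : Prop :=
  weakly_measurable U /\ integrableR P (fun w => W w * `|U w| ^+ 2).

(** For nonnegative [W] this is the semi-inner product of the space of [H]-valued maps
    square-integrable for the measure [W dP]. *)
Definition winner {d : measure_display} {T : measurableType d}
    {R : realType} (P : probability T R) {H : hilbertType R} (W : T -> R)
    (U V : T -> H) : R :=
  expec P (fun w => W w * [<U w, V w>]).

Section WeightedL2.
Context {d : measure_display} {T : measurableType d} {R : realType}.
Context {P : probability T R} {H : hilbertType R} {W : T -> R}.
Local Notation weighted_L2 := (weighted_L2 P W).
Local Notation winner := (winner P W).
Context {D : pred nat} {phi : nat -> H}.
Hypothesis phiB : orthonormal_basis D phi.
Hypothesis W0 : forall w, 0 <= W w.
Hypothesis Wi : integrableR P W.
Implicit Types U V : T -> H.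

Let mW := integrableR_measurable Wi.

Lemma measurable_norm_sqr {U} : weakly_measurable U ->
  measurable_fun [set: T] (fun w => `|U w| ^+ 2).
Proof.
move=> mU; under eq_fun do rewrite -inner_norm.
exact: (measurable_inner phiB mU mU).
Qed.

Lemma normrD_sqr_le (x y : H) : `|x + y| ^+ 2 <= 2 * `|x| ^+ 2 + 2 * `|y| ^+ 2.
Proof.
have := sqr_ge0 `|x - y|.
by rewrite -!inner_norm !(innerBl, innerBr, innerDl, innerDr) (innerC y x); lra.
Qed.

Lemma weighted_L2_cst (a : H) : weighted_L2 (fun=> a).
Proof.
split; first exact: weakly_measurable_cst.
by apply: eq_integrableR (integrableRZ (`|a| ^+ 2) Wi) => w; rewrite mulrC.
Qed.

Lemma weighted_L2D {U V} : weighted_L2 U -> weighted_L2 V ->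
  weighted_L2 (fun w => U w + V w).
Proof.
move=> [mU Ui] [mV Vi]; split; first exact: weakly_measurableD.
apply: integrableR_le (integrableRD (integrableRZ 2 Ui) (integrableRZ 2 Vi)).
  apply: measurable_funM => //; apply: measurable_norm_sqr.
  exact: weakly_measurableD.
move=> w /=; rewrite ger0_norm ?mulr_ge0 ?sqr_ge0// !(mulrCA 2 (W w)) -mulrDr.
by rewrite ler_wpM2l// normrD_sqr_le.
Qed.

Lemma weighted_L2Z (a : R) {U} : weighted_L2 U -> weighted_L2 (fun w => a *: U w).
Proof.
move=> [mU Ui]; split; first exact: weakly_measurableZ.
apply: eq_integrableR (integrableRZ (a ^+ 2) Ui) => w.
by rewrite normrZ exprMn real_normK ?num_real//; ring.
Qed.

Lemma weighted_L2N {U} : weighted_L2 U -> weighted_L2 (fun w => - U w).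
Proof. by move/(weighted_L2Z (-1)); under eq_fun do rewrite scaleN1r. Qed.

Lemma weighted_L2B {U V} : weighted_L2 U -> weighted_L2 V ->
  weighted_L2 (fun w => U w - V w).
Proof. by move=> Ui /weighted_L2N; exact: weighted_L2D. Qed.

Lemma weighted_L2_linear {Z : T -> H} {C : {linear H -> H}} :
  weakly_measurable (fun w => C (Z w)) -> continuous C -> weighted_L2 Z ->
  weighted_L2 (fun w => C (Z w)).
Proof.
move=> mCZ cC [mZ Zi]; split => //.
have /linear_boundedP[r [rr hr]] := (linear_bounded_continuous C).2 cC.
(* The bound on [C] is available for every constant strictly above [r]; [r + 1] is one. *)
have {hr} := hr (r + 1); rewrite ltrDl => /(_ ltr01) Cle.
apply: integrableR_le (integrableRZ ((r + 1) ^+ 2) Zi).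
  by apply: measurable_funM => //; exact: measurable_norm_sqr.
move=> w /=; rewrite ger0_norm ?mulr_ge0 ?sqr_ge0// (mulrCA _ (W w)) ler_wpM2l// -exprMn.
by rewrite lerXn2r ?nnegrE// (le_trans _ (Cle _)).
Qed.

Lemma integrable_coef {U V} (e f : H) : weighted_L2 U -> weighted_L2 V ->
  integrableR P (fun w => W w * ([<U w, e>] * [<V w, f>])).
Proof.
move=> [mU Ui] [mV Vi].
apply: integrableR_le (integrableRZ (`|e| * `|f|) (integrableRD Ui Vi)).
  by apply: measurable_funM => //; exact: measurable_funM.
move=> w /=; rewrite normrM ger0_norm// -mulrDr mulrCA ler_wpM2l// normrM.
apply: (le_trans (ler_pM _ _ (cauchy_schwarz _ _) (cauchy_schwarz _ _))) => //.
rewrite mulrACA mulrC ler_wpM2l ?mulr_ge0//.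
have := sqr_ge0 (`|U w| - `|V w|).
have := mulr_ge0 (normr_ge0 (U w)) (normr_ge0 (V w)); nra.
Qed.

Lemma integrable_winner {U V} : weighted_L2 U -> weighted_L2 V ->
  integrableR P (fun w => W w * [<U w, V w>]).
Proof.
move=> [mU Ui] [mV Vi].
apply: integrableR_le (integrableRD Ui Vi).
  by apply: measurable_funM => //; exact: (measurable_inner phiB mU mV).
move=> w /=; rewrite normrM ger0_norm// -mulrDr ler_wpM2l//.
apply: (le_trans (cauchy_schwarz _ _)).
have := sqr_ge0 (`|U w| - `|V w|).
have := mulr_ge0 (normr_ge0 (U w)) (normr_ge0 (V w)); nra.
Qed.

Lemma winnerC U V : winner U V = winner V U.
Proof. by apply: eq_expec => w; rewrite innerC. Qed.

Lemma winnerDl U U' V : weighted_L2 U -> weighted_L2 U' -> weighted_L2 V ->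
  winner (fun w => U w + U' w) V = winner U V + winner U' V.
Proof.
move=> Ui Ui' Vi; rewrite /winner -expecD; [|exact: integrable_winner..].
by apply: eq_expec => w; rewrite innerDl mulrDr.
Qed.

Lemma winnerZl (a : R) U V : weighted_L2 U -> weighted_L2 V ->
  winner (fun w => a *: U w) V = a * winner U V.
Proof.
move=> Ui Vi; rewrite /winner -expecZ; last exact: integrable_winner.
by apply: eq_expec => w; rewrite innerZl mulrCA.
Qed.

Lemma winner_quadratic {U V} (t : R) : weighted_L2 U -> weighted_L2 V ->
  winner (fun w => U w + t *: V w) (fun w => U w + t *: V w) =
  winner U U + t * (2 * winner U V) + t ^+ 2 * winner V V.
Proof.
move=> Ui Vi; have tVi := weighted_L2Z t Vi; have Si := weighted_L2D Ui tVi.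
rewrite winnerDl// winnerZl// (winnerC U) (winnerC V) !winnerDl// !winnerZl//.
by rewrite (winnerC V U); ring.
Qed.

(** Parseval holds pointwise, and its partial sums times [W] are dominated by
    [W * |U|^2 + W * |V|^2]. *)
Lemma winner_parseval {U V} : weighted_L2 U -> weighted_L2 V ->
  is_sum D (fun k => expec P (fun w => W w * ([<U w, phi k>] * [<V w, phi k>])))
    (winner U V).
Proof.
move=> Ui Vi; rewrite /is_sum.
pose F n w := \sum_(k < n | D k) W w * ([<U w, phi k>] * [<V w, phi k>]).
have FE n : \sum_(k < n | D k) expec P (fun w => W w * ([<U w, phi k>] * [<V w, phi k>]))
    = expec P (F n).
  have [|_ ->//] := @integrableR_expec_sum _ _ _ P _ (index_enum 'I_n)
    (fun k => D k) (fun k w => W w * ([<U w, phi k>] * [<V w, phi k>])).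
  by move=> k _; exact: integrable_coef.
under eq_fun do rewrite FE.
apply: (expec_dominated_cvg (fun w => W w * `|U w| ^+ 2 + W w * `|V w| ^+ 2)).
- move=> n; rewrite /F; under eq_fun do rewrite big_mkcond.
  apply: measurable_sum => k; case: (D k); last exact: measurable_cst.
  exact: integrableR_measurable (integrable_coef _ _ Ui Vi).
- move=> w /=; rewrite /F; under eq_fun do rewrite -mulr_sumr.
  by apply: cvgMr; exact: parseval.
- move=> n w; rewrite /F -mulr_sumr normrM ger0_norm// -mulrDr ler_wpM2l//.
  apply: (le_trans (partial_parseval_le phiB _ _ _)).
  have := sqr_ge0 (`|U w| - `|V w|).
  have := mulr_ge0 (normr_ge0 (U w)) (normr_ge0 (V w)); nra.
- by apply: integrableRD; [case: Ui|case: Vi].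
Qed.

Lemma expecH_winner {U} : weighted_L2 U ->
  forall f, [<expecH P (fun w => W w *: U w), f>] = winner U (fun=> f).
Proof.
move=> [mU Ui] f.
(* Since [|U| <= 1 + |U|^2], the weight and the weighted second moment together dominate
   [W *: U]. *)
rewrite (expecH_inner phiB _ (fun w => W w + W w * `|U w| ^+ 2)).
- by apply: eq_expec => w; rewrite innerZl.
- exact: weakly_measurableZ.
- move=> w /=; rewrite normrZ ger0_norm// -{2}(mulr1 (W w)) -mulrDr ler_wpM2l//.
  have := sqr_ge0 (`|U w| - 1); have := normr_ge0 (U w); nra.
- exact: integrableRD.
Qed.

End WeightedL2.

(** * The local linear loss *)

Section LocalLinearLoss.
Context {d : measure_display} {T : measurableType d} {R : realType}.
Context {P : probability T R} {H : hilbertType R}.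
Context {W : T -> R} {X Y : T -> H} {x0 : H}.
Context {D : pred nat} {phi : nat -> H}.
Hypothesis phiB : orthonormal_basis D phi.
Hypothesis W0 : forall w, 0 <= W w.
Hypothesis Wi : integrableR P W.
Hypothesis rX : random_element X.
Hypothesis XL : weighted_L2 P W (fun w => X w - x0).
Hypothesis YL : weighted_L2 P W Y.
Implicit Types (h : H) (C : {linear H -> H}).

Let L := local_loss P W X Y x0.
(** The residual carries the sign of the normal equations, opposite to the one inside the loss;
    squaring hides the difference. *)
Let res (b0 : H) (b1 : H -> H) w := b0 - Y w + b1 (X w - x0).

Lemma weighted_L2_shift {C} : continuous C ->
  weighted_L2 P W (fun w => C (X w - x0)).
Proof.
move=> cC; apply: (weighted_L2_linear phiB W0 Wi _ cC XL).
apply: (@weakly_measurable_comp _ _ _ _ X (fun x => C (x - x0))) => // x.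
apply: (cvg_comp (fun x : H => x - x0) C _ (cC _)).
by apply: cvgB; [exact: cvg_id|exact: cvg_cst].
Qed.

Lemma weighted_L2_residual {b0 : H} {b1 : {linear H -> H}} : continuous b1 ->
  weighted_L2 P W (res b0 b1).
Proof.
move=> c1; apply: (weighted_L2D phiB W0 Wi); last exact: weighted_L2_shift.
apply: (weighted_L2B phiB W0 Wi) => //; exact: weighted_L2_cst.
Qed.

Lemma local_lossE (b0 : H) (b1 : H -> H) :
  L b0 b1 = winner P W (res b0 b1) (res b0 b1).
Proof.
apply: eq_expec => w; rewrite inner_norm mulrC; congr (_ * _ ^+ 2).
by rewrite -[RHS]normrN /res opprD opprB.
Qed.

(** One expansion serves perturbations of [b0] and of [b1]: each moves the residual along a fixed
    direction [V]. *)
Lemma local_loss_quadratic (b0 : H) (b1 : {linear H -> H}) (V : T -> H)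
    (t : R) (c0 : H) (c1 : H -> H) :
  continuous b1 -> weighted_L2 P W V ->
  (forall w, res c0 c1 w = res b0 b1 w + t *: V w) ->
  L c0 c1 = L b0 b1 + t * (2 * winner P W (res b0 b1) V) +
            t ^+ 2 * winner P W V V.
Proof.
move=> cb1 VL E; rewrite !local_lossE -(winner_quadratic phiB W0 Wi)//; last first.
  exact: weighted_L2_residual.
by rewrite (_ : res c0 c1 = fun w => res b0 b1 w + t *: V w)//; exact: funext.
Qed.

Lemma is_derive_local_loss0 (b0 : H) (b1 : {linear H -> H}) h : continuous b1 ->
  is_derive b0 h (fun b => L b b1) (2 * winner P W (res b0 b1) (fun=> h)).
Proof.
move=> c1; apply: (is_derive_quadratic (winner P W (fun=> h) (fun=> h))) => t.
apply: local_loss_quadratic => //; first exact: weighted_L2_cst.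
by move=> w; rewrite /res -!addrA addrC -!addrA.
Qed.

Lemma is_derive_local_loss1 (b0 : H) (b1 : {linear H -> H}) C : continuous b1 -> continuous C ->
  is_derive (0 : R) (1 : R) (fun t : R => L b0 (fun x => b1 x + t *: C x))
    (2 * winner P W (res b0 b1) (fun w => C (X w - x0))).
Proof.
move=> c1 cC; have CL := weighted_L2_shift cC.
apply: (is_derive_quadratic
  (winner P W (fun w => C (X w - x0)) (fun w => C (X w - x0)))) => t.
rewrite (_ : (fun x => b1 x + 0 *: C x) = b1); last first.
  by apply: funext => x; rewrite scale0r addr0.
apply: local_loss_quadratic => // w.
by rewrite /res scaler1 addr0 addrA.
Qed.

(** The derivatives are twice the weighted inner products of the residual with the perturbation, so
    stationarity is orthogonality to the constants and to all [C (X - x0)]. *)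
Lemma loss_stationaryP (b0 : H) (b1 : {linear H -> H}) : continuous b1 ->
  loss_stationary P W X Y x0 b0 b1 <->
  (forall h, winner P W (res b0 b1) (fun=> h) = 0) /\
  (forall C, continuous C -> winner P W (res b0 b1) (fun w => C (X w - x0)) = 0).
Proof.
move=> c1; rewrite /loss_stationary.
have E0 h : 'D_h (fun b => L b b1) b0 = 2 * winner P W (res b0 b1) (fun=> h).
  by have [_] := is_derive_local_loss0 b0 b1 h c1.
have E1 C : continuous C ->
    derive1 (fun t : R => L b0 (fun x => b1 x + t *: C x)) 0 =
    2 * winner P W (res b0 b1) (fun w => C (X w - x0)).
  by move=> cC; rewrite derive1E; have [_] := is_derive_local_loss1 b0 b1 C c1 cC.
split=> -[h0 h1]; split=> [h|C cC].
- by have := h0 h; rewrite E0 => /eqP; rewrite mulf_eq0 pnatr_eq0/= => /eqP.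
- by have := h1 C cC; rewrite E1// => /eqP; rewrite mulf_eq0 pnatr_eq0/= => /eqP.
- by rewrite E0 h0 mulr0.
- by rewrite E1// h1// mulr0.
Qed.

(** A minimizer is compared with bundled linear maps only, so the perturbed operator has to be
    packed as one. *)
Lemma continuous_linearD (b1 C : {linear H -> H}) (t : R) :
  continuous b1 -> continuous C ->
  exists2 c1 : {linear H -> H}, continuous c1 & forall x, c1 x = b1 x + t *: C x.
Proof.
move=> cb cC; pose c1 x := b1 x + t *: C x.
have lc1 : linear c1.
  by move=> a x y; rewrite /c1 !linearP !scalerDr !scalerA (mulrC a t) addrACA.
pose c1L := GRing.isLinear.Build _ _ _ _ c1 lc1.
pose c1' : {linear H -> H} := HB.pack c1 c1L.
exists c1' => // x; apply: cvgD; first exact: cb.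
by apply: cvgZr; exact: cC.
Qed.

(** Along each admissible line the excess over the minimum is [t * p + t^2 * q >= 0], which forces
    [p = 0]. *)
Lemma loss_minimizer_stationary (b0 : H) (b1 : {linear H -> H}) : continuous b1 ->
  loss_minimizer P W X Y x0 b0 b1 -> loss_stationary P W X Y x0 b0 b1.
Proof.
move=> cb1 bmin; apply/loss_stationaryP => //.
have min0 (V : T -> H) : weighted_L2 P W V ->
    (forall t : R, exists c0 : H, exists2 c1 : {linear H -> H}, continuous c1 &
      forall w, res c0 c1 w = res b0 b1 w + t *: V w) ->
    winner P W (res b0 b1) V = 0.
  move=> VL ht; have : 2 * winner P W (res b0 b1) V = 0.
    apply: (@quadratic_min _ _ (winner P W V V)) => t.
    have [c0 [c1 cc1 E]] := ht t.
    have := bmin c0 c1 cc1.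
    by rewrite -/L (local_loss_quadratic b0 b1 V t c0 c1)// -addrA lerDl.
  by move=> /eqP; rewrite mulf_eq0 pnatr_eq0/= => /eqP.
split=> [h|C cC]; apply: min0.
- exact: weighted_L2_cst.
- move=> t; exists (t *: h + b0), b1 => // w.
  by rewrite /res -!addrA addrC -!addrA.
- exact: weighted_L2_shift.
- move=> t; exists b0; have [c1 cc1 E] := continuous_linearD b1 C t cb1 cC.
  by exists c1 => // w; rewrite /res E addrA.
Qed.

Lemma normal_eq0P (b0 : H) (b1 : {linear H -> H}) : continuous b1 ->
  normal_eq0 P W X Y x0 b0 b1 <->
  forall h, winner P W (res b0 b1) (fun=> h) = 0.
Proof.
move=> c1; have E := expecH_winner phiB W0 Wi (weighted_L2_residual (b0 := b0) c1).
split=> [h0 h|h0]; first by rewrite -E [X in [<X, _>]]h0 inner0l.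
by apply: inner_ext => h; rewrite inner0l [LHS]E.
Qed.

(** The second normal equation is the orthogonality condition for the single direction [C = id]. *)
Lemma normal_eq1P (b0 : H) (b1 : {linear H -> H}) :
  normal_eq1 P W X Y x0 b0 b1 <->
  winner P W (res b0 b1) (fun w => X w - x0) = 0.
Proof.
rewrite /normal_eq1 (_ : expec P _ = winner P W (res b0 b1) (fun w => X w - x0))//.
apply: eq_expec => w; congr (_ * _).
by rewrite /res !innerDl !innerNl; ring.
Qed.

End LocalLinearLoss.

(** * Orthogonality of the regression error *)

Section RegressionError.
Context {d : measure_display} {T : measurableType d} {R : realType}.
Context {P : probability T R} {H : hilbertType R}.
Context {D : pred nat} {phi : nat -> H}.
Hypothesis phiB : orthonormal_basis D phi.
Context {X eps : T -> H}.
Hypothesis rX : random_element X.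
Hypothesis reps : random_element eps.
Hypothesis eps_mean : cond_expecH P X eps (fun=> 0).

Lemma weakly_measurable_random {Z : T -> H} :
  random_element Z -> weakly_measurable Z.
Proof. by move=> rZ; apply: (weakly_measurable_comp (g := id)) rZ _ => x. Qed.

Lemma integrable_error f : integrableR P (fun w => [<eps w, f>]).
Proof.
have [[_ ie] _ _ _] := eps_mean.
apply: integrableR_le (integrableRZ `|f| ie).
  exact: weakly_measurable_random.
by move=> w /=; rewrite (le_trans (cauchy_schwarz _ _))// mulrC.
Qed.

(** Pairing the vector identity in [cond_expecH] with [f] turns it into a scalar one, whose
    right-hand side comes from the zero map. *)
Lemma error_indicator_orthogonal f (B : set (borel H)) : measurable B ->
  expec P (fun w => \1_B (X w) * [<eps w, f>]) = 0.
Proof.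
move=> mB; have [[_ ie] _ _ /(_ B mB) E] := eps_mean.
have mI : measurable_fun [set: T] (fun w => \1_B (X w) : R).
  by apply: (@measurableT_comp _ _ _ _ _ _ (\1_B : borel H -> R)) rX.
have I1 w : `|\1_B (X w) : R| <= 1.
  by rewrite indicE; case: (_ \in _); rewrite ?normr1 ?normr0.
transitivity [<expecH P (fun w => (\1_B (X w) : R) *: eps w), f>].
  rewrite (expecH_inner phiB _ (fun w => `|eps w|))//.
  - by apply: eq_expec => w; rewrite innerZl.
  - by apply: weakly_measurableZ => //; exact: weakly_measurable_random.
  - by move=> w; rewrite normrZ ler_piMl.
rewrite E (expecH_inner phiB _ (fun=> 0)).
- by rewrite -[RHS](expec0 (P := P)); apply: eq_expec => w; rewrite scaler0 inner0l.
- by move=> g; under eq_fun do rewrite scaler0; exact: weakly_measurable_cst.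
- by move=> w; rewrite scaler0 normr0.
- exact: integrable0.
Qed.

Context {W : T -> R}.
Hypothesis W0 : forall w, 0 <= W w.
Hypothesis Wi : integrableR P W.

(** Parseval reduces the claim to coordinates. As [W] is a function of [X], the [j]-th term is the
    mean of [q (X) * <eps, phi j>], which vanishes by conditional orthogonality. [E] is an almost
    sure copy of [eps], because the regression model holds only almost surely. *)
Lemma winner_error0 (k : borel H -> R) (E : T -> H) (g : H -> H) :
  measurable_fun [set: borel H] k -> (forall w, W w = k (X w)) ->
  {ae P, forall w, eps w = E w} -> continuous g ->
  weighted_L2 P W E -> weighted_L2 P W (g \o X) ->
  winner P W E (g \o X) = 0.
Proof.
move=> mk Wk epsE cg EL gL.
apply: is_sum_unique (winner_parseval phiB W0 Wi EL gL) _.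
apply: (@eq_is_sum _ _ _ (fun=> 0)); last first.
  by rewrite /is_sum; under eq_fun do rewrite big1//; exact: cvg_cst.
move=> j Dj; apply/esym.
pose q (x : borel H) := k x * [<g x, phi j>].
have mq : measurable_fun [set: borel H] q.
  apply: measurable_funM => //; apply: continuous_measurable_borel => x.
  exact: cvg_comp (cg x) (inner_continuousl (phi j) (g x)).
have mepsj : measurable_fun [set: T] (fun w => [<eps w, phi j>]).
  exact: weakly_measurable_random.
have mqe : measurable_fun [set: T] (fun w => q (X w) * [<eps w, phi j>]).
  apply: measurable_funM => //.
  by apply: (@measurableT_comp _ _ _ _ _ _ q) rX.
have iE := integrable_coef W0 Wi (phi j) (phi j) EL gL.
have ae : {ae P, forall w, W w * ([<E w, phi j>] * [<g (X w), phi j>]) =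
    q (X w) * [<eps w, phi j>]}.
  by apply: filterS epsE => w ->; rewrite /q Wk; ring.
rewrite (expec_ae (integrableR_measurable iE) mqe ae).
apply: (expec_measurable_mul0 rX (integrable_error (phi j))) => //.
  exact: error_indicator_orthogonal.
exact: integrableR_ae iE.
Qed.

End RegressionError.

(** * The local linear estimators and predictor *)

Lemma measurable_scaled_kernel {R : realType} {H : hilbertType R} {K : R -> R}
    (b : R) (x0 : H) :
  measurable_fun [set: R] K ->
  measurable_fun [set: borel H] (fun x : borel H => scaled_kernel K b `|(x : H) - x0|).
Proof.
move=> mK; apply: measurable_funM; first exact: measurable_cst.
apply: (@measurableT_comp _ _ _ _ _ _ K) => //.
apply: continuous_measurable_borel => x.
apply: cvgMl; apply: (@cvg_norm); apply: cvgB; [exact: cvg_id|exact: cvg_cst].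
Qed.

Theorem mainTheorem1 (d : measure_display) (T : measurableType d)
  (R : realType) (P : probability T R) (H : hilbertType R)
  (sepH : separable H)
  (* regression model *)
  (X Y eps : T -> H) (m : H -> H) (sigma : R)
  (rX : random_element X) (rY : random_element Y) (reps : random_element eps)
  (model : {ae P, forall w, Y w = m (X w) + eps w})
  (eps_mean : cond_expecH P X eps (fun=> 0))
  (eps_var : cond_expecR P X (fun w => `|eps w| ^+ 2) (fun=> sigma ^+ 2))
  (* Frechet derivative and its spectral expansion *)
  (A : {linear H -> H}) (A_cont : continuous A)
  (m_diff : forall x : H, is_diff x m A)
  (A_sa : self_adjoint A) (A_compact : compact_operator A)
  (D : pred nat) (phi : nat -> H) (lam : nat -> R)
  (phi_basis : orthonormal_basis D phi)
  (A_spec : spectral_expansion D phi lam A)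
  (* kernel, bandwidths, sample size *)
  (K : R -> R) (K_density : probability_density K)
  (B : nat -> R) (B_gt0 : forall n, 0 < B n) (B_cvg : B @ \oo --> (0 : R))
  (n : nat) (x0 : H) :
  let W w := scaled_kernel K (B n) `|X w - x0| in
  let xi k w := [<X w - x0, phi k>] in
  let y k w := [<Y w, phi k>] in
  let mu0 := expec P W in
  let mu1 := expecH P (fun w => W w *: (X w - x0)) in
  let r0 := expecH P (fun w => W w *: Y w) in
  let mu j k := expec P (fun w => xi k w ^+ j * W w) in
  let r j k := expec P (fun w => W w * xi k w ^+ j * y k w) in
  let L := local_loss P W X Y x0 in
  let sigma02 k := mu 2%N k * mu0 - mu 1%N k ^+ 2 in
  let summand (l : nat -> R) k :=
    l k * (mu 2%N k - mu 1%N k ^+ 2 / mu0) - r 1%N k + r 0%N k * mu 1%N k / mu0 in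
  let lamhat k := (mu0 * r 1%N k - r 0%N k * mu 1%N k) / sigma02 k in
  let mhat k := (r 0%N k - lamhat k * mu 1%N k) / mu0 in
  let Sk k w := (sigma02 k)^-1 * W w * (mu 2%N k - mu 1%N k * xi k w) in
  (* the expectations of the statement are finite *)
  integrableR P W ->
  integrableR P (fun w => W w * `|X w - x0| ^+ 2) ->
  integrableR P (fun w => W w * `|Y w| ^+ 2) ->
  (forall k, D k -> integrableR P (fun w => W w * xi k w * y k w ^+ 2)) ->
  (* the denominators do not vanish *)
  mu0 != 0 ->
  (forall k, D k -> sigma02 k != 0) ->
  [/\ (* loss and normal equations, at every candidate diagonal in phi *)
      (forall (b0 : H) (b1 : {linear H -> H}) (l : nat -> R),
        continuous b1 -> spectral_expansion D phi l b1 ->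
        [/\ is_sum D
              (fun k => expec P (fun w =>
                 (y k w - [<b0, phi k>] - l k * xi k w) ^+ 2 * W w))
              (L b0 b1),
            (forall h : H, is_derive b0 h (fun b => L b b1)
               (2 * [<expecH P (fun w =>
                        W w *: (b0 - Y w + b1 (X w - x0))), h>])) /\
            (forall C : {linear H -> H}, continuous C ->
               is_derive (0 : R) (1 : R)
                 (fun t : R => L b0 (fun x => b1 x + t *: C x))
                 (2 * expec P (fun w =>
                   W w * [<b0 - Y w + b1 (X w - x0), C (X w - x0)>]))),
            (loss_minimizer P W X Y x0 b0 b1 ->
               loss_stationary P W X Y x0 b0 b1) /\
            (loss_stationary P W X Y x0 b0 b1 ->
               normal_eq0 P W X Y x0 b0 b1 /\ normal_eq1 P W X Y x0 b0 b1),
            (normal_eq0 P W X Y x0 b0 b1 ->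
               b0 = mu0^-1 *: (r0 - b1 mu1) /\
               forall k, D k ->
                 [<b0, phi k>] = (r 0%N k - l k * mu 1%N k) / mu0) &
            (normal_eq1 P W X Y x0 b0 b1 <->
               is_sum D (fun k => l k * mu 2%N k - r 1%N k + [<b0, phi k>] * mu 1%N k)
                 (0 : R)) /\
            (normal_eq0 P W X Y x0 b0 b1 ->
               (normal_eq1 P W X Y x0 b0 b1 <->
                  is_sum D (summand l) (0 : R)))]),
      (* the equations hold at (m x0, A) *)
      loss_stationary P W X Y x0 (m x0) A,
      (* the estimated eigenvalues and operator *)
      [/\ forall l : nat -> R, (forall k, D k -> summand l k = 0) ->
            is_sum D (summand l) (0 : R),
          forall (l : nat -> R) k, D k ->
            (summand l k = 0 <-> l k = lamhat k) &
          exists2 Ahat : {linear H -> H}, continuous Ahat &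
            forall f g : H,
              is_sum D (fun k => lamhat k * [<f, phi k>] * [<g, phi k>])
                [<Ahat f, g>]],
      (* the coefficients of the estimated regression value *)
      (forall k, D k ->
        [/\ mhat k = (mu 2%N k * r 0%N k - mu 1%N k * r 1%N k) / sigma02 k,
            mhat k = expec P (fun w => Sk k w * y k w),
            expec P (Sk k) = 1 &
            forall h : H,
              (forall g : H,
                 expec P (fun w => Sk k w * (y k w - [<h, phi k>]) ^+ 2) <=
                 expec P (fun w => Sk k w * (y k w - [<g, phi k>]) ^+ 2)) <->
              [<h, phi k>] = mhat k]) &
      (* the predictor *)
      exists2 Yhat : H, is_sum D (fun k => mhat k *: phi k) Yhat &
        forall k, D k -> [<Yhat, phi k>] = mhat k].
Proof.
move=> W xi y mu0 mu1 r0 mu r L sigma02 summand lamhat mhat Sk.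
move=> Wi WXi WYi Wxyy mu0_neq0 sigma_neq0.
have [mK K0 _] := K_density.
have W0 w : 0 <= W w by rewrite mulr_ge0// invr_ge0 ltW.
have c_shift : continuous (fun x : H => x - x0).
  by move=> x; apply: cvgB; [exact: cvg_id|exact: cvg_cst].
have XL : weighted_L2 P W (fun w => X w - x0).
  by split => //; exact: (weakly_measurable_comp (g := fun x => x - x0) rX).
have YL : weighted_L2 P W Y by split => //; exact: weakly_measurable_random.
have cL (h : H) : weighted_L2 P W (fun=> h) := weighted_L2_cst Wi h.
have i1 k : integrableR P (fun w => W w * xi k w).
  exact: (integrable_winner phi_basis W0 Wi XL (cL (phi k))).
have iy k : integrableR P (fun w => W w * y k w).
  exact: (integrable_winner phi_basis W0 Wi YL (cL (phi k))).
have i2 k : integrableR P (fun w => W w * (xi k w * xi k w)).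
  exact: (integrable_coef W0 Wi (phi k) (phi k) XL XL).
have ixy k : integrableR P (fun w => W w * (xi k w * y k w)).
  exact: (integrable_coef W0 Wi (phi k) (phi k) XL YL).
have iyy k : integrableR P (fun w => W w * (y k w * y k w)).
  exact: (integrable_coef W0 Wi (phi k) (phi k) YL YL).
have mu1E k : expec P (fun w => W w * xi k w) = mu 1%N k.
  by apply: eq_expec => w; rewrite expr1 mulrC.
have mu2E k : expec P (fun w => W w * (xi k w * xi k w)) = mu 2%N k.
  by apply: eq_expec => w; rewrite expr2 mulrC.
have r0E k : expec P (fun w => W w * y k w) = r 0%N k.
  by apply: eq_expec => w; rewrite expr0 mulr1.
have r1E k : expec P (fun w => W w * (xi k w * y k w)) = r 1%N k.
  by apply: eq_expec => w; rewrite expr1 mulrA.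
(* [comb0] and [comb1] express through the local moments the weighted mean of an affine combination
   of the coordinates, and that of its product with [xi k]. *)
have comb0 k (a b c : R) :
    expec P (fun w => W w * (a - c * y k w + b * xi k w)) =
    a * mu0 - c * r 0%N k + b * mu 1%N k.
  rewrite -r0E -mu1E -!expecZ// -expecB; [|exact: integrableRZ..].
  rewrite -expecD; [|apply: integrableRB; exact: integrableRZ|exact: integrableRZ].
  by apply: eq_expec => w; ring.
have comb1 k (a b : R) :
    expec P (fun w => W w * ((a - y k w + b * xi k w) * xi k w)) =
    a * mu 1%N k - r 1%N k + b * mu 2%N k.
  rewrite -r1E -mu1E -mu2E -!expecZ// -expecB//; last exact: integrableRZ.
  rewrite -expecD; [|apply: integrableRB => //; exact: integrableRZ|exact: integrableRZ].
  by apply: eq_expec => w; ring.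
have mu1k k : [<mu1, phi k>] = mu 1%N k.
  by rewrite (expecH_winner phi_basis W0 Wi XL); exact: mu1E.
have r0k k : [<r0, phi k>] = r 0%N k.
  by rewrite (expecH_winner phi_basis W0 Wi YL); exact: r0E.
have resL (b0 : H) (b1 : {linear H -> H}) (cb1 : continuous b1) :=
  weighted_L2_residual phi_basis W0 Wi rX XL YL (b0 := b0) cb1.
have resk (b0 : H) (b1 : {linear H -> H}) (l : nat -> R) w k :
    spectral_expansion D phi l b1 -> D k ->
    [<b0 - Y w + b1 (X w - x0), phi k>] = [<b0, phi k>] - y k w + l k * xi k w.
  by move=> sp Dk; rewrite innerDl innerBl (spectral_coef phi_basis _ sp Dk).
have coefE (b0 : H) (b1 : {linear H -> H}) (l : nat -> R) :
    continuous b1 -> spectral_expansion D phi l b1 ->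
    normal_eq0 P W X Y x0 b0 b1 -> forall k, D k ->
    [<b0, phi k>] = (r 0%N k - l k * mu 1%N k) / mu0.
  move=> cb1 sp /(normal_eq0P phi_basis W0 Wi rX XL YL _ _ cb1) n0 k Dk.
  have := n0 (phi k); rewrite /winner.
  have := comb0 k [<b0, phi k>] (l k) 1.
  rewrite (@eq_expec _ _ _ _ _
    (fun w => W w * [<b0 - Y w + b1 (X w - x0), phi k>])); last first.
    by move=> w; rewrite (resk _ _ l)// mul1r.
  move=> -> e; apply: (mulIf mu0_neq0); rewrite divfK//.
  by rewrite mul1r in e; lra.
have mE := affine_of_diff_const m_diff x0.
(* As [m] is affine, the residual at [(m x0, A)] is almost surely [- eps]; the factor [-1] below
   restores the error itself. *)
have orth (g : H -> H) : continuous g -> weighted_L2 P W (g \o X) ->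
    winner P W (fun w => m x0 - Y w + A (X w - x0)) (g \o X) = 0.
  move=> cg gL; have RL := resL (m x0) A A_cont.
  have RNL := weighted_L2Z (-1) RL.
  have := winner_error0 phi_basis rX reps eps_mean W0 Wi
    (fun x : borel H => scaled_kernel K (B n) `|(x : H) - x0|) _ g
    (measurable_scaled_kernel _ _ mK) (fun=> erefl) _ cg RNL gL.
  rewrite (winnerZl phi_basis W0 Wi)// mulN1r => h.
  apply: oppr_inj; rewrite oppr0; apply: h.
  apply: filterS model => w ->; rewrite (mE (X w)) scaleN1r opprD opprB.
  by rewrite -[RHS]addrA -opprD (addrC (m x0 + _)) addrK.
have statA : loss_stationary P W X Y x0 (m x0) A.
  apply/(loss_stationaryP phi_basis W0 Wi rX XL YL _ _ A_cont); split=> [h|C cC].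
    by apply: (orth (fun=> h)); [move=> x; exact: cvg_cst|exact: cL].
  apply: (orth (fun x => C (x - x0))).
    by move=> x; exact: cvg_comp (c_shift x) (cC (x - x0)).
  exact: (weighted_L2_shift phi_basis W0 Wi rX XL cC).
have nA : normal_eq0 P W X Y x0 (m x0) A.
  move/(loss_stationaryP phi_basis W0 Wi rX XL YL _ _ A_cont): (statA) => [s0 _].
  exact/(normal_eq0P phi_basis W0 Wi rX XL YL _ _ A_cont).
have m0k := coefE _ _ _ A_cont A_spec nA.
have m1k k : D k ->
    [<m x0, phi k>] * mu 1%N k - r 1%N k + lam k * mu 2%N k = 0.
  move=> Dk; rewrite -comb1.
  (* This test function isolates the [k]-th summand of the second normal equation, so at [(m x0, A)]
     each summand vanishes, not just their sum. *)
  pose g x := [<x - x0, phi k>] *: phi k.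
  have cg : continuous g.
    move=> x; apply: cvgZl.
    exact: cvg_comp (c_shift x) (inner_continuousl (phi k) (x - x0)).
  rewrite -(orth g cg).
    by apply: eq_expec => w; rewrite /g/= innerZr (resk _ _ lam)// (mulrC (xi k w)).
  split; first exact: weakly_measurable_comp.
  apply: eq_integrableR (i2 k) => w.
  by rewrite -inner_norm /g/= innerZl innerZr (inner_basis phi_basis)// eqxx mulr1.
(* [m0k] and [m1k] form a linear system for [<m x0, phi k>] and [lam k] with determinant [sigma02 k]
   up to sign; eliminating the first unknown leaves the formula for [lamhat k]. *)
have lamE k : D k -> lamhat k = lam k.
  move=> Dk; have := m1k k Dk; rewrite (m0k k Dk) => e.
  apply: (mulIf (sigma_neq0 k Dk)); rewrite divfK ?sigma_neq0//.
  have -> : r 1%N k = (r 0%N k - lam k * mu 1%N k) / mu0 * mu 1%N k + lam k * mu 2%N k.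
    by lra.
  by rewrite /sigma02; field.
have mhatE k : D k -> mhat k = [<m x0, phi k>].
  by move=> Dk; rewrite /mhat lamE// m0k.
split => //.
- move=> b0 b1 l cb1 sp.
  (* Parseval for the residual against [X - x0] gives the series form of the second normal
     equation. *)
  have sumE : is_sum D
      (fun k => l k * mu 2%N k - r 1%N k + [<b0, phi k>] * mu 1%N k)
      (winner P W (fun w => b0 - Y w + b1 (X w - x0)) (fun w => X w - x0)).
    apply: eq_is_sum (winner_parseval phi_basis W0 Wi (resL b0 b1 cb1) XL) => k Dk.
    transitivity ([<b0, phi k>] * mu 1%N k - r 1%N k + l k * mu 2%N k); last by ring.
    by rewrite -comb1; apply: eq_expec => w; rewrite (resk _ _ l).
  have eq1P : normal_eq1 P W X Y x0 b0 b1 <-> is_sum D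
      (fun k => l k * mu 2%N k - r 1%N k + [<b0, phi k>] * mu 1%N k) (0 : R).
    split; first by move/normal_eq1P => e; move: sumE; rewrite e.
    by move=> s0; apply/normal_eq1P; exact: is_sum_unique sumE s0.
  split.
  - rewrite /L local_lossE.
    apply: eq_is_sum (winner_parseval phi_basis W0 Wi (resL b0 b1 cb1) (resL b0 b1 cb1)) => k Dk.
    by apply: eq_expec => w; rewrite !(resk _ _ l)//; ring.
  - split=> [h|C cC]; last exact: (is_derive_local_loss1 phi_basis W0 Wi rX XL YL).
    rewrite (expecH_winner phi_basis W0 Wi (resL b0 b1 cb1)).
    exact: (is_derive_local_loss0 phi_basis W0 Wi rX XL YL).
  - split; first exact: (loss_minimizer_stationary phi_basis W0 Wi rX XL YL).
    move/(loss_stationaryP phi_basis W0 Wi rX XL YL _ _ cb1) => [s0 s1]; split.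
      exact/(normal_eq0P phi_basis W0 Wi rX XL YL _ _ cb1).
    (* The identity operator is an admissible direction for [beta_1]. *)
    by apply/normal_eq1P; apply: (s1 idfun) => x; exact: cvg_id.
  - move=> n0; split; last exact: coefE cb1 sp n0.
    apply: (basis_ext phi_basis) => k Dk.
    rewrite innerZl innerBl (spectral_coef phi_basis _ sp Dk) mu1k r0k mulrC.
    exact: coefE cb1 sp n0 k Dk.
  - split=> // n0.
    have se k : D k -> l k * mu 2%N k - r 1%N k + [<b0, phi k>] * mu 1%N k = summand l k.
      by move=> Dk; rewrite (coefE _ _ _ cb1 sp n0 k Dk) /summand; field.
    split=> [/eq1P|s0]; first exact: eq_is_sum.
    by apply/eq1P; apply: eq_is_sum s0 => k Dk; rewrite se.
- split.
  + move=> l s0; apply: (@eq_is_sum _ _ _ (fun=> 0)) => [k Dk|]; first by rewrite s0.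
    by rewrite /is_sum; under eq_fun do rewrite big1//; exact: cvg_cst.
  + move=> l k Dk; have sn := sigma_neq0 k Dk.
    (* Each summand is a nonzero multiple of [l k - lamhat k]. *)
    have E : summand l k * mu0 = (l k - lamhat k) * sigma02 k.
      by rewrite /summand mulrBl divfK// /sigma02; field.
    split=> [s0|e].
      move: E; rewrite s0 mul0r => /esym/eqP; rewrite mulf_eq0 (negPf sn) orbF.
      by rewrite subr_eq0 => /eqP.
    by apply/eqP; move/eqP: E; rewrite e subrr mul0r mulf_eq0 (negPf mu0_neq0) orbF.
  (* Since [lamhat] agrees with [lam] on [D], the estimated operator is [A] itself, which settles
     boundedness and convergence. *)
  + exists A => // f g; have [_ Af] := A_spec.
    apply: eq_is_sum (is_sum_inner g (Af f)) => k Dk.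
    by rewrite innerZl lamE// (innerC g).
- move=> k Dk; have sn := sigma_neq0 k Dk.
  have m1 : mhat k = (mu 2%N k * r 0%N k - mu 1%N k * r 1%N k) / sigma02 k.
    rewrite /mhat /lamhat; move: sn; rewrite /sigma02 => sn; field.
    by rewrite sn mu0_neq0.
  have m2 : mhat k = expec P (fun w => Sk k w * y k w).
    rewrite m1 mulrC -r0E -r1E -!expecZ// -expecB; [|exact: integrableRZ..].
    rewrite -expecZ; last by apply: integrableRB; exact: integrableRZ.
    by apply: eq_expec => w; rewrite /Sk; ring.
  have m3 : expec P (Sk k) = 1.
    transitivity ((sigma02 k)^-1 * (mu 2%N k * mu0 - mu 1%N k * mu 1%N k)); last first.
      by rewrite -expr2 mulVf.
    rewrite -{2}mu1E -!expecZ// -expecB; [|exact: integrableRZ..].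
    rewrite -expecZ; last by apply: integrableRB; exact: integrableRZ.
    by apply: eq_expec => w; rewrite /Sk; ring.
  have iS : integrableR P (Sk k).
    apply: eq_integrableR (integrableRZ (sigma02 k)^-1 (integrableRB
      (integrableRZ (mu 2%N k) Wi) (integrableRZ (mu 1%N k) (i1 k)))) => w.
    by rewrite /Sk; ring.
  have iSy : integrableR P (fun w => Sk k w * y k w).
    apply: eq_integrableR (integrableRZ (sigma02 k)^-1 (integrableRB
      (integrableRZ (mu 2%N k) (iy k)) (integrableRZ (mu 1%N k) (ixy k)))) => w.
    by rewrite /Sk; ring.
  (* The factor [xi k] in [Sk] brings in the mixed third-order moment assumed finite in [Wxyy]. *)
  have iSyy : integrableR P (fun w => Sk k w * y k w ^+ 2).
    apply: eq_integrableR (integrableRZ (sigma02 k)^-1 (integrableRB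
      (integrableRZ (mu 2%N k) (iyy k)) (integrableRZ (mu 1%N k) (Wxyy k Dk)))) => w.
    by rewrite /Sk; ring.
  (* As [Sk k] has mean 1, the objective is a constant plus [(c - mhat k)^2], so it is minimized at
     [mhat k] even though [Sk k] may take negative values. *)
  have SE c : expec P (fun w => Sk k w * (y k w - c) ^+ 2) =
      expec P (fun w => Sk k w * y k w ^+ 2) - (2 * c) * mhat k + c ^+ 2.
    have -> : c ^+ 2 = c ^+ 2 * expec P (Sk k) by rewrite m3 mulr1.
    rewrite m2 -!expecZ// -expecB//; last exact: integrableRZ.
    rewrite -expecD; [|apply: integrableRB => //; exact: integrableRZ|exact: integrableRZ].
    by apply: eq_expec => w; ring.
  split => // h; split=> [hmin|hE g].
    (* This competitor has [k]-th coordinate [mhat k]. *)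
    have := hmin (mhat k *: phi k).
    rewrite !SE innerZl (inner_basis phi_basis)// eqxx mulr1 => le.
    apply/eqP; rewrite -subr_eq0 -sqrf_eq0 eq_le sqr_ge0 andbT.
    by rewrite sqrrB; lra.
  rewrite !SE hE; have := sqr_ge0 ([<g, phi k>] - mhat k).
  by rewrite sqrrB; lra.
(* The coefficients [mhat k] are those of [m x0], so the predictor series is its basis expansion. *)
- exists (m x0) => [|k Dk]; last by rewrite mhatE.
  by apply: eq_is_sum (basis_expansion phi_basis (m x0)) => k Dk; rewrite mhatE.
Qed.
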